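(* Let $q\ge 90$ be an integer, let $\lambda>0$ satisfy $e^{\lambda}>q^3 4^{q+1}$, and let $0<\beta<\infty$. Then the Gibbs measure with states $[q+1]$ and parameters $\lambda,\beta$ (defined in the context) has uniqueness on the infinite $q$-ary tree.
   Context: The infinite $q$-ary tree is the infinite rooted tree in which every vertex has exactly $q$ children. The model. Write $[q+1]=\{1,\dots,q+1\}$. For parameters $\lambda,\beta>0$ and a finite graph $G=(V,E)$, the Gibbs measure is the probability distribution on $[q+1]^V$ given by $$P(\sigma)=\frac1Z\exp\Big[\lambda\sum_{u\in V}1_{\{\sigma_u=q+1\}}-\beta\sum_{(u,v)\in E}\eta(\sigma_u,\sigma_v)\Big],$$ where $Z$ is the normalizing constant and $\eta(i,j)=1$ if $1\le i=j\le q$, or if $i=q+1$ and $j\in\{1,2\}$, or if $j=q+1$ and $i\in\{1,2\}$, and $\eta(i,j)=0$ otherwise. Infinite graphs and uniqueness. Let $G=(V,E)$ be an infinite graph with finite degrees. For a finite set $A\subset V$ put $S(A,n)=\{u\in V: d(u,A)=n\}$, where $d$ is graph distance. For $\sigma^*\in[q+1]^{S(A,n)}$, $P(\sigma_A=\cdot\mid\sigma_{S(A,n)}=\sigma^* )$ denotes the law of the restriction of $\sigma$ to $A$ under the Gibbs measure $P(\sigma)=\frac1Z\exp\big[\lambda\sum_{u\in V'}1_{\{\sigma_u=q+1\}}-\beta\sum_{(u,v)\in E'}\eta(\sigma_u,\sigma_v)\big]$ on the finite subgraph $(V',E')$ induced by $V'=\{u: d(u,A)\le n\}$, conditioned on $\sigma=\sigma^*$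 on $S(A,n)$ (by the Markov property the rest of the graph is irrelevant). The Gibbs measure has uniqueness on $G$ if for every finite $A\subset V$, $$\lim_{n\to\infty}\ \sup_{\sigma^1,\sigma^2} d_{TV}\big(P(\sigma_A=\cdot\mid\sigma_{S(A,n)}=\sigma^1),\,P(\sigma_A=\cdot\mid\sigma_{S(A,n)}=\sigma^2)\big)=0,$$ where $d_{TV}$ is total variation distance and the supremum is over all boundary conditions $\sigma^1,\sigma^2\in[q+1]^{S(A,n)}$. *)

(* Defs.v *)
From mathcomp Require Import all_boot all_order all_algebra.
From mathcomp Require Import finmap.
From mathcomp Require Import boolp classical_sets functions cardinality.
From mathcomp Require Import reals topology normedtype sequences exp.

Set Implicit Arguments.
Unset Strict Implicit.
Unset Printing Implicit Defensive.

Import Order.TTheory GRing.Theory Num.Theory.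
Import numFieldNormedType.Exports.

Local Open Scope classical_set_scope.
Local Open Scope ring_scope.

(* Simple graphs with finite degrees; the vertex set may be infinite. *)
Record lfgraph := LFGraph {
  vertex : choiceType;
  adj : rel vertex;
  adj_sym : symmetric adj;
  adj_irr : irreflexive adj;
  adj_finite : forall u, finite_set [set v | adj u v]
}.

Section Distance.
Variable G : lfgraph.
Implicit Types (u v : vertex G) (A : {fset vertex G}) (n : nat).

Definition walk u v n :=
  exists p : seq (vertex G), [/\ path (@adj G) u p, last u p = v & size p = n].

(* d(u, A) = n; never holds when no walk joins u to A (infinite distance). *)
Definition dist_to A u n :=
  (exists2 a, a \in A & walk a u n) /\
  (forall a m, a \in A -> walk a u m -> (n <= m)%N).

Definition ball_set A n : set (vertex G) :=
  [set u | exists2 m, (m <= n)%N & dist_to A u m].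

Definition sphere_set A n : set (vertex G) := [set u | dist_to A u n].

(* fset_set is the empty set on infinite sets, but ball_set and sphere_set are
   finite: see in_gball and in_gsphere. *)
Definition gball A n : {fset vertex G} := fset_set (ball_set A n).

Definition gsphere A n : {fset vertex G} := fset_set (sphere_set A n).

Lemma finite_walk u n : finite_set [set v | walk u v n].
Proof.
elim: n => [|n IHn].
  apply: (sub_finite_set _ (finite_set1 u)) => v [p [_ + /size0nil p0]].
  by rewrite p0 /= => ->.
apply: (@sub_finite_set _ _
  (\bigcup_(w in [set w | walk u w n]) [set v | adj w v])).
  move=> v [p [pp lp sp]].
  case/lastP: p => [|p x] in pp lp sp *; first by [].
  move: pp lp sp; rewrite rcons_path last_rcons size_rcons.
  move=> /andP[pp ax] <- [sp]; exists (last u p) => //.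
  by exists p.
by apply: bigcup_finite => // w _; apply: adj_finite.
Qed.

Lemma finite_ball_set A n : finite_set (ball_set A n).
Proof.
apply: (@sub_finite_set _ _
  (\bigcup_(m in `I_n.+1) \bigcup_(a in [set` A]) [set v | walk a v m])).
  by move=> u [m mn [[a aA w] _]]; exists m => //; exists a.
apply: bigcup_finite; first exact: finite_II.
move=> m _; apply: bigcup_finite; first exact: finite_fset.
by move=> a _; apply: finite_walk.
Qed.

Lemma sphere_sub_ball A n : sphere_set A n `<=` ball_set A n.
Proof. by move=> u; exists n. Qed.

Lemma in_gball A n u : (u \in gball A n) <-> ball_set A n u.
Proof.
by rewrite /gball in_fset_set ?inE //; apply: finite_ball_set.
Qed.

Lemma in_gsphere A n u : (u \in gsphere A n) <-> sphere_set A n u.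
Proof.
rewrite /gsphere in_fset_set ?inE //.
exact: sub_finite_set (@sphere_sub_ball A n) (finite_ball_set A n).
Qed.

Lemma gball_center A n : (A `<=` gball A n)%fset.
Proof.
apply/fsubsetP => a aA; apply/in_gball; exists 0%N => //; split=> //.
by exists a => //; exists [::].
Qed.

Lemma gball_sphere A n : (gsphere A n `<=` gball A n)%fset.
Proof.
by apply/fsubsetP => a /in_gsphere; move/sphere_sub_ball/in_gball.
Qed.

End Distance.

Definition state (q : nat) := 'I_q.+1.

(* The state with value i in {0, ..., q} is the state i + 1 of [q+1]. *)
Definition label q (s : state q) : nat := s.+1.

Definition eta q (s t : state q) : bool :=
  let i := label s in let j := label t in
  [|| [&& 1 <= i, i == j & j <= q],
      (i == q.+1) && (j \in [:: 1; 2]) |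
      (j == q.+1) && (i \in [:: 1; 2])]%N.

Section FiniteGibbs.
Variables (R : realType) (q : nat) (lambda beta : R).
Variables (T : finType) (e : rel T).
Let config := {ffun T -> state q}.

(* Each edge is met twice as an ordered pair, hence the factor 1/2. *)
Definition gibbs_weight (s : config) : R :=
  expR (lambda * \sum_(u : T) (label (s u) == q.+1)%:R
        - beta * (2^-1 * \sum_(p : T * T | e p.1 p.2) (eta (s p.1) (s p.2))%:R)).

Definition gibbs_Z : R := \sum_(s : config) gibbs_weight s.

Definition gibbs (s : config) : R := gibbs_weight s / gibbs_Z.

Definition gibbs_pr (E : pred config) : R := \sum_(s | E s) gibbs s.

Definition gibbs_cond (E F : pred config) : R :=
  gibbs_pr (predI E F) / gibbs_pr F.

End FiniteGibbs.

Definition dTV (R : realType) (T : finType) (mu nu : T -> R) : R :=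
  2^-1 * \sum_(x : T) `|mu x - nu x|.

Section Uniqueness.
Variables (R : realType) (q : nat) (lambda beta : R) (G : lfgraph).

Definition restr (A B : {fset vertex G}) (AB : (A `<=` B)%fset)
    (s : {ffun B -> state q}) : {ffun A -> state q} :=
  [ffun a => s (fincl AB a)].

Definition induced_adj (B : {fset vertex G}) : rel B :=
  fun u v => adj (val u) (val v).

(* P(sigma_A = . | sigma_S(A,n) = xi) *)
Definition boundary_law (A : {fset vertex G}) (n : nat)
    (xi : {ffun gsphere A n -> state q}) (tau : {ffun A -> state q}) : R :=
  gibbs_cond lambda beta (@induced_adj (gball A n))
    (fun s => restr (gball_center A n) s == tau)
    (fun s => restr (gball_sphere A n) s == xi).

Definition gibbs_uniqueness : Prop :=
  forall A : {fset vertex G},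
    (fun n : nat => sup [set d : R |
       exists xi1 xi2 : {ffun gsphere A n -> state q},
         d = dTV (boundary_law xi1) (boundary_law xi2)])
    @ \oo --> (0 : R).

End Uniqueness.

Section Tree.
Variable q : nat.

(* Vertices are words over 'I_q: [::] is the root, and the children of u are
   the words i :: u. *)
Definition child (u v : seq 'I_q) : bool := [exists i : 'I_q, v == i :: u].

Definition tree_adj : rel (seq 'I_q) := fun u v => child u v || child v u.

Lemma tree_adj_sym : symmetric tree_adj.
Proof. by move=> u v; rewrite /tree_adj orbC. Qed.

Lemma tree_adj_irr : irreflexive tree_adj.
Proof.
move=> u; rewrite /tree_adj orbb /child; apply/existsP => -[i /eqP/(congr1 size)].
by move=> /= /n_Sn.
Qed.

Lemma tree_adj_finite u : finite_set [set v | tree_adj u v].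
Proof.
apply: (@sub_finite_set _ _
  ([set i :: u | i in [set: 'I_q]] `|` [set behead u])).
  rewrite /tree_adj /child => v /= /orP[] /existsP[i /eqP ->]; last by right.
  by left; exists i.
by rewrite finite_setU; split; [apply: finite_image; apply: finite_finset|].
Qed.

Definition qtree : lfgraph := LFGraph tree_adj_sym tree_adj_irr tree_adj_finite.

End Tree.

(* Main.v *)
Require Import Defs.
From mathcomp Require Import all_boot all_order all_algebra finmap.
From mathcomp Require Import zify ring lra.
From mathcomp Require Import boolp classical_sets.
From mathcomp Require Import reals topology normedtype sequences exp.
Set Implicit Arguments.
Unset Strict Implicit.
Unset Printing Implicit Defensive.
Import Order.TTheory GRing.Theory Num.Theory.
Import numFieldNormedType.Exports.
Local Open Scope ring_scope.

(** On a tree, the law of the spin at a vertex [w], in the subtree hanging from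
[w], is a function of the laws at the children of [w] ([step], then
[normalize]). Write [star] for the state [q+1], of activity [expR lambda]; the
other states are the colours, and the plain colours are those that do not
interact with [star], that is all but the first two. A boundary condition far
away is forgotten in three stages.

Whatever the children are, a vertex has a given plain colour with probability
at most [1 - d], where [d > 0] is tiny when [beta] is large: a boundary
condition can almost freeze the colours. Freezing is unstable, though. There
are [q] children for [q - 2] plain colours, so many of the colours are forbidden
by one child at most, hence allowed with weight at least of order [d] each.
Their sum is several times [d], and [d] doubles in each generation until it
reaches one half ([growth], [spread_step]). One generation later the plain
colours weigh so much that the first two colours have probability at most one
half altogether ([low_step]).

Only the first two colours of a child penalize [star], so [star] then has weight
at least [expR lambda / 2 ^+ q], much more than the [q] colours, whose weights
are at most one each. All laws are close to a point mass at [star], and the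
recursion contracts the L1 distance by one half ([step_contract]). Iterating,
the laws at a vertex far from the boundary depend on the boundary condition only
up to a factor close to one ([ratio_deep]).

The law of the spins in a finite set [A] is a quotient of two sums over the
configurations near the root, in which the laws at the vertices of a fixed
generation enter as factors ([msg_top]). Factors that are close to one stay so
in these finite products ([top_le], [cond_msg_ratio]). Two facts connect this
with the definition of uniqueness: the Gibbs weight of a finite tree can be
summed by passing messages from the leaves to the root ([sum_tree],
[gibbs_condE]), and the ball of radius [n] around [A] is a subtree that contains
the root and meets the sphere only in generations after [n - M], where the
vertices of [A] lie in the first [M] generations ([gball_behead],
[gsphere_small]). *)

(** * Escape from frozen colours *)

Section Growth.
Variable R : realType.

(** Applying [1 + t <= expR t] to [t = x / (1 - x)] inverts it into a lower
bound for [1 - x]. *)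
Lemma expR_le_1B (x : R) : 0 <= x -> x <= 2^-1 -> expR (- (2 * x)) <= 1 - x.
Proof.
move=> x0 x2; have x1 : 0 < 1 - x by lra.
rewrite expRN -[leRHS]invrK lef_pV2 ?posrE ?invr_gt0 ?expR_gt0 //.
have e : (1 - x)^-1 = 1 + x / (1 - x) by field; lra.
rewrite e; apply: le_trans (expR_ge1Dx _) _; rewrite ler_expR.
rewrite ler_pdivrMr //; nra.
Qed.

(* 2 = 32 / 16, and 1 - 1/16 is large enough for the 32nd power to exceed 1/9. *)
Lemma expRN2_ge : (9^-1 : R) <= expR (- 2).
Proof.
have -> : (- 2 : R) = 32%:R * - 16^-1 by field.
rewrite expRM_natl.
have h : (15 / 16 : R) <= expR (- 16^-1).
  by apply: le_trans (expR_ge1Dx _); lra.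
apply: (le_trans _ (lerXn2r 32 _ _ h)); rewrite ?nnegrE ?expR_ge0 //; lra.
Qed.

Variables (I C : finType) (x : I -> C -> R) (d : R).
Hypothesis (x_ge0 : forall c i, 0 <= x c i).
Hypothesis (x_sum : forall c, \sum_i x c i <= 1).
Hypothesis (d_gt0 : 0 < d).

Let big c i := 2^-1 < x c i.
Let nbig i := #|[pred c | big c i]|.
Let small i := \sum_(c | ~~ big c i) x c i.

Lemma big_uniq (K : {pred C}) c : (\sum_(i in K | big c i) 1 <= 1)%N.
Proof.
rewrite sum1_card; apply/card_le1_eqP => i j.
move=> /andP[_ bi] /andP[_ bj]; apply/eqP/contraT => ij.
have := x_sum c; rewrite (bigD1 i) //= (bigD1 j) /=; last by rewrite ?ij // eq_sym ij.
have : 0 <= \sum_(k | (k != i) && (k != j)) x c k by apply: sumr_ge0.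
by move: bi bj; rewrite /big => *; lra.
Qed.

(** At most one [x c i] exceeds one half, and its factor is at least [d]. The
other factors are bounded through [1 - x >= exp (- 2 x)], and the exponential by its tangent at
[small i = 1], the average value of the sums when the masses are spread
evenly. *)
Lemma prod_1B_ge i : (forall c, x c i <= 1 - d) -> d <= 1 -> (nbig i <= 1)%N ->
  d * expR (- 2) * (3 - 2 * small i) <= \prod_c (1 - x c i).
Proof.
have d0 := d_gt0.
move=> xi d1 ni.
have x1 c : 0 <= 1 - x c i by have := xi c => ?; lra.
have hbig : d <= \prod_(c | big c i) (1 - x c i).
  apply: (@le_trans _ _ (\prod_(c | big c i) d)); last first.
    by apply: ler_prod => c _; rewrite ltW //=; have := xi c => ?; lra.
  rewrite prodr_const -/(nbig i).
  by case: (nbig i) ni => [|[|//]] _; rewrite ?expr0 ?expr1.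
have hsmall : expR (- (2 * small i)) <= \prod_(c | ~~ big c i) (1 - x c i).
  rewrite /small mulr_sumr -sumrN expR_sum; apply: ler_prod => c.
  by rewrite /big -leNgt expR_ge0 => hc; rewrite expR_le_1B.
rewrite (bigID (fun c => big c i)) /=.
apply: (@le_trans _ _ (d * expR (- (2 * small i)))); last first.
  by apply: ler_pM => //; rewrite ?expR_ge0 // ltW.
rewrite -mulrA; apply: ler_wpM2l; first exact: ltW.
have -> : - (2 * small i) = - 2 + (2 - 2 * small i) by ring.
rewrite expRD; apply: ler_wpM2l; first exact: expR_ge0.
by apply: le_trans (expR_ge1Dx _); lra.
Qed.

(** Seen by a vertex with [q] children, [\prod_c (1 - x c i)] is the weight of
the colour [i]. A colour is nearly forbidden when two children are likely to
have it; the pigeonhole principle leaves about half of the colours at least with at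
most one such child, and on average those weigh at least a constant times [d]. *)
Lemma growth (K : {pred C}) :
  (#|I| <= #|K| + 3)%N -> (90 <= #|I|)%N -> d <= 2^-1 ->
  (forall c i, i \in K -> x c i <= 1 - d) ->
  4 * d <= \sum_(i in K) \prod_c (1 - x c i).
Proof.
have d0 := d_gt0.
move=> cK cI d2 xd; have d1 : d <= 1 by lra.
pose N := #|[pred i in K | (nbig i <= 1)%N]|.
pose M := #|[pred i in K | (1 < nbig i)%N]|.
have KNM : (#|K| = N + M)%N.
  rewrite /N /M -!sum1_card (bigID (fun i => (nbig i <= 1)%N)) /=; congr addn.
  by apply: eq_bigl => i; rewrite !inE ltnNge.
have M2 : (2 * M <= \sum_(i in K | (1 < nbig i)%N) nbig i)%N.
  rewrite /M -sum1_card big_distrr /=.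
  rewrite (eq_bigl (fun i => (i \in K) && (1 < nbig i)%N)); last first.
    by move=> i; rewrite !inE.
  by apply: leq_sum => i /andP[_]; rewrite muln1.
have sC : (\sum_(i in K) nbig i <= #|I|)%N.
  rewrite (eq_bigr (fun i => (\sum_(c | big c i) 1)%N)); last by move=> i _; rewrite sum1_card.
  rewrite (exchange_big_dep predT) //= -sum1_card.
  by apply: leq_sum => c _; exact: big_uniq.
have sC2 : (\sum_(i in K | (1 < nbig i)%N) nbig i <= \sum_(i in K) nbig i)%N.
  by rewrite [leqRHS](bigID (fun i => (1 < nbig i)%N)) /= leq_addr.
(* Each child has total mass at most one, and a big entry takes one half. *)
have mass : \sum_(i in K | (nbig i <= 1)%N) small i + M%:R <= #|I|%:R.
  have h : \sum_(i in K | (nbig i <= 1)%N) small i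
      + 2^-1 * (\sum_(i in K | (1 < nbig i)%N) nbig i)%N%:R <= #|I|%:R.
    have -> : (#|I|%:R : R) = \sum_(c : I) 1 by rewrite sumr_const.
    rewrite /small (exchange_big_dep predT) //= natr_sum mulr_sumr.
    rewrite (eq_bigr (fun i => \sum_(c | big c i) (2^-1 : R))); last first.
      by move=> i _; rewrite sumr_const mulr_natr.
    rewrite [X in _ + X](exchange_big_dep predT) //= -big_split /=.
    apply: ler_sum => c _; apply: le_trans (x_sum c).
    rewrite [leRHS](bigID (fun i => (i \in K) && (nbig i <= 1)%N)) /=.
    apply: lerD.
      rewrite [leRHS](bigID (fun i => big c i)) /= addrC.
      rewrite -[leLHS]addr0; apply: lerD => //.
      by apply: sumr_ge0.
    rewrite [leRHS](bigID (fun i => (i \in K) && big c i)) /= -[leLHS]addr0.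
    apply: lerD; last by apply: sumr_ge0.
    apply: (@le_trans _ _ (\sum_(i | ((i \in K) && (1 < nbig i)%N) && big c i)
      x c i)); first by apply: ler_sum => i /andP[_] /ltW.
    rewrite le_eqVlt; apply/orP; left; apply/eqP; apply: eq_bigl => i.
    by case: (i \in K); rewrite //= -ltnNge.
  have : (2 * M)%N%:R <= (\sum_(i in K | (1 < nbig i)%N) nbig i)%N%:R :> R.
    by rewrite ler_nat.
  by rewrite natrM => ?; lra.
(* N >= #|I| - 3 - M and M <= #|I| / 2 leave at least #|I| / 2 - 9. *)
have large : 36 <= \sum_(i in K | (nbig i <= 1)%N) (3 - 2 * small i).
  rewrite big_split /= sumr_const sumrN -mulr_sumr.
  have -> : #|[pred i in K | (nbig i <= 1)%N]| = N by [].
  have h : (2 * #|I| + 36 <= 3 * N + 2 * M)%N by lia.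
  have : (2 * #|I| + 36)%N%:R <= (3 * N + 2 * M)%N%:R :> R by rewrite ler_nat.
  rewrite (natrD _ (2 * #|I|)%N) (natrD _ (3 * N)%N) !natrM -mulr_natr => ?.
  by lra.
rewrite (bigID (fun i => (nbig i <= 1)%N)) /= -[leLHS]addr0; apply: lerD.
  apply: (@le_trans _ _ (\sum_(i in K | (nbig i <= 1)%N)
     (d * expR (- 2) * (3 - 2 * small i)))); last first.
    by apply: ler_sum => i /andP[iK ni]; apply: prod_1B_ge => // c; apply: xd.
  rewrite -mulr_sumr -mulrA [leLHS]mulrC; apply: ler_wpM2l; first exact: ltW.
  have := expRN2_ge; set E := expR _ => hE.
  by apply: (@le_trans _ _ (E * 36)); [lra | apply: ler_wpM2l; [lra|]].
apply: sumr_ge0 => i /andP[iK _]; apply: prodr_ge0 => c _.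
by have := xd c _ iK => ?; lra.
Qed.

End Growth.

(** * The tree recursion *)

Section Normalize.
Variables (R : realType) (S : finType).
Implicit Types F x : S -> R.

Definition prob x := (forall s, 0 <= x s) /\ \sum_s x s = 1.

Definition normalize F s : R := F s / \sum_t F t.

Lemma prob_normalize F :
  (forall s, 0 <= F s) -> 0 < \sum_s F s -> prob (normalize F).
Proof.
move=> F0 sF; split=> [s|]; first by rewrite divr_ge0 // ltW.
by rewrite -mulr_suml divff // gt_eqF.
Qed.

Lemma prob_le1 x s : prob x -> x s <= 1.
Proof. by move=> [x0 <-]; rewrite (bigD1 s) //= lerDl sumr_ge0. Qed.

Lemma normalizeZ (c : R) F : c != 0 ->
  normalize (fun s => c * F s) =1 normalize F.
Proof. by move=> c0 s; rewrite /normalize -mulr_sumr -mulf_div divff ?mul1r. Qed.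

Lemma prob_compl x (P : pred S) :
  prob x -> \sum_(s | ~~ P s) x s = 1 - \sum_(s | P s) x s.
Proof.
by move=> [_ <-]; rewrite [in RHS](bigID P) /=; ring.
Qed.

End Normalize.

Section Step.
Variables (R : realType) (q : nat) (lambda beta : R).
Hypothesis (beta_gt0 : 0 < beta).

Implicit Types (s t : state q) (x : 'I_q -> state q -> R).

Definition activity s : R := expR (lambda * (label s == q.+1)%:R).

Definition edge s t : R := expR (- (beta * (eta s t)%:R)).

Definition edge_avg s (p : state q -> R) := \sum_t edge s t * p t.

(** One step of the tree recursion: [x c] is the law of the spin of the
child [c] in its own subtree, [step x] is the unnormalized law of the spin of
the parent. *)
Definition step x s : R := activity s * \prod_c edge_avg s (x c).

Lemma etaC s t : eta s t = eta t s.
Proof.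
rewrite /eta /label; apply/idP/idP => /or3P[/and3P[a /eqP b c]|H|H].
- by rewrite -b eqxx a b c.
- by rewrite H !orbT.
- by rewrite H !orbT.
- by rewrite -b eqxx a b c.
- by rewrite H !orbT.
- by rewrite H !orbT.
Qed.

(** Values start at [0]: these are the colours that interact only with
themselves. *)
Definition plain s := (2 <= s < q)%N.

Lemma eta_plain s t : plain s -> eta s t = (t == s).
Proof.
rewrite /plain /eta /label => /andP[s2 sq].
rewrite !inE !eqSS -(inj_eq val_inj) /=.
have h := ltn_ord t; lia.
Qed.

Lemma eta_star t : (2 < q)%N -> eta ord_max t = (t < 2)%N.
Proof.
rewrite /eta /label /= !inE !eqSS => q2.
have h := ltn_ord t; lia.
Qed.

Lemma activity_ge1 s : 0 < lambda -> 1 <= activity s.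
Proof.
by move=> l0; rewrite /activity -[leLHS]expR0 ler_expR mulr_ge0 // ltW.
Qed.

Lemma activity_star : activity ord_max = expR lambda.
Proof. by rewrite /activity /label eqxx mulr1. Qed.

Lemma activity_colour s : s != ord_max -> activity s = 1.
Proof.
rewrite -(inj_eq val_inj) /= => sq.
by rewrite /activity /label eqSS (negPf sq) mulr0 expR0.
Qed.

Lemma edge_le1 s t : edge s t <= 1.
Proof.
have b0 := ltW beta_gt0.
by rewrite /edge -[leRHS]expR0 ler_expR oppr_le0 mulr_ge0.
Qed.

Lemma edge_ge s t : expR (- beta) <= edge s t.
Proof.
have b0 := beta_gt0; rewrite /edge ler_expR lerN2.
by case: (eta s t); rewrite ?mulr1 ?mulr0 // ltW.
Qed.

Lemma edge_avg_ge0 s (p : state q -> R) :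
  (forall t, 0 <= p t) -> 0 <= edge_avg s p.
Proof. by move=> p0; apply: sumr_ge0 => t _; rewrite mulr_ge0 // expR_ge0. Qed.

Lemma edge_avg_le1 s p : prob p -> edge_avg s p <= 1.
Proof.
move=> [p0 <-]; apply: ler_sum => t _.
by rewrite -[leRHS]mul1r ler_wpM2r // edge_le1.
Qed.

Lemma edge_avg_ge s p : prob p -> expR (- beta) <= edge_avg s p.
Proof.
move=> [p0 p1]; rewrite -[leLHS]mulr1 -p1 mulr_sumr.
by apply: ler_sum => t _; rewrite ler_wpM2r // edge_ge.
Qed.

Lemma edge_avg_gt0 s p : prob p -> 0 < edge_avg s p.
Proof. by move=> /(edge_avg_ge s); apply: lt_le_trans; apply: expR_gt0. Qed.

(** The states that do not interact with [s] keep their full probability. *)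
Lemma edge_avg_ge1B s p : prob p ->
  1 - \sum_(t | eta s t) p t <= edge_avg s p.
Proof.
move=> pp; rewrite -prob_compl // /edge_avg; have [p0 _] := pp.
rewrite [leRHS](bigID (eta s)) /= -[leLHS]add0r; apply: lerD.
  by apply: sumr_ge0 => t _; rewrite mulr_ge0 // expR_ge0.
apply: ler_sum => t /negPf st; rewrite /edge st mulr0 oppr0 expR0.
by rewrite mul1r.
Qed.

Section Children.
Variable x : 'I_q -> state q -> R.
Hypothesis (x_prob : forall c, prob (x c)).

Let hit s := \prod_c edge_avg s (x c).

Lemma hit_le1 s : 0 <= hit s <= 1.
Proof.
rewrite prodr_ile1 ?prodr_ge0 // => c _.
- by apply: edge_avg_ge0 => t; case: (x_prob c).
- by rewrite edge_avg_le1 // edge_avg_ge0 // => t; case: (x_prob c).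
Qed.

Lemma step_gt0 s : 0 < step x s.
Proof.
rewrite /step mulr_gt0 ?expR_gt0 // prodr_gt0 // => c _.
exact: edge_avg_gt0.
Qed.

Lemma step_colour_le1 s : s != ord_max -> step x s <= 1.
Proof.
by move=> sq; rewrite /step activity_colour // mul1r; case/andP: (hit_le1 s).
Qed.

Lemma step_ge s : 0 < lambda -> expR (- beta) ^+ q <= step x s.
Proof.
move=> l0; rewrite /step -[leLHS]mul1r; apply: ler_pM => //.
- by rewrite exprn_ge0 // expR_ge0.
- exact: activity_ge1.
rewrite -[X in _ ^+ X](card_ord q) -prodr_const; apply: ler_prod => c _.
by rewrite expR_ge0 edge_avg_ge.
Qed.

Lemma sum_step_gt0 : 0 < \sum_s step x s.
Proof.
rewrite (bigD1 ord0) //= ltr_pwDl ?step_gt0 // sumr_ge0 // => s _.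
by rewrite ltW // step_gt0.
Qed.

Lemma prob_step : prob (normalize (step x)).
Proof.
by apply: prob_normalize sum_step_gt0 => s; rewrite ltW // step_gt0.
Qed.

Lemma step_plain_ge s : plain s -> \prod_c (1 - x c s) <= step x s.
Proof.
move=> ps; have sq : s != ord_max.
  by rewrite -(inj_eq val_inj) /= neq_ltn; case/andP: ps => _ ->.
rewrite /step activity_colour // mul1r; apply: ler_prod => c _.
rewrite subr_ge0 prob_le1 //=; apply: le_trans (edge_avg_ge1B _ _) => //.
by rewrite (eq_bigl (pred1 s)) ?big_pred1_eq // => t; rewrite /= eta_plain.
Qed.

End Children.

Lemma card_plain : (2 < q)%N -> (q <= #|plain| + 2)%N.
Proof.
move=> q2; have : (#|[predC plain]| <= 3)%N.
  apply: (@leq_trans #|[:: ord0; inord 1; ord_max : state q]|).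
    apply/subset_leq_card/fintype.subsetP => s; rewrite !inE.
    rewrite unfold_in /= -!(inj_eq val_inj) /= inordK; last by lia.
    by rewrite /plain; have := ltn_ord s; lia.
  exact: card_size.
by rewrite -(leq_add2l #|plain|) cardC card_ord => ?; lia.
Qed.

(** The larger [d], the further [p] is from freezing a plain colour. *)
Definition spread (d : R) (p : state q -> R) :=
  forall s, plain s -> p s <= 1 - d.

(** A colour [k] competes with the other plain colours, whose total weight is
at least [4 d] when the children are spread by [d]. *)
Lemma spread_step x (d : R) : (90 <= q)%N -> 0 < d -> d <= 2^-1 ->
  (forall c, prob (x c)) -> (forall c, spread d (x c)) ->
  spread (Num.min (2^-1) (2 * d)) (normalize (step x)).
Proof.
move=> q90 d0 d2 px sx k pk.
pose K := [predD1 plain & k].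
have kstar : k != ord_max.
  by rewrite -(inj_eq val_inj) /= neq_ltn; case/andP: pk => _ ->.
have cK : (#|'I_q| <= #|K| + 3)%N.
  have h : (2 < q)%N by lia.
  have := card_plain h; rewrite card_ord (cardD1 k) -/K.
  by rewrite [k \in _]pk add1n addSn -addnS.
have large : 4 * d <= \sum_(s in K) step x s.
  apply: le_trans (growth _ _ d0 cK _ d2 (x := x) _) _.
  - by move=> c s; case: (px c).
  - by move=> c; case: (px c) => _ ->.
  - by rewrite card_ord.
  - by move=> c s /andP[_ ps]; apply: sx.
  by apply: ler_sum => s /andP[_ ps]; apply: step_plain_ge.
have := step_gt0 px k; have := step_colour_le1 px kstar.
have rest : 0 <= \sum_(s | (s != k) && ~~ plain s) step x s.
  by apply: sumr_ge0 => s _; rewrite ltW // step_gt0.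
rewrite /normalize ler_pdivrMr ?sum_step_gt0 // (bigD1 k) //=.
rewrite (bigID plain) /=; move: rest large.
set a := \sum_(i | _) _; set b := \sum_(i in K) _.
(* The claim amounts to m * z <= (1 - m) * (b + a), where 1 - m >= 1/2. *)
set z := step x k => a0 b0 z1 z0; set m := Num.min _ _.
have [m2 md] : m <= 2^-1 /\ m <= 2 * d.
  by rewrite /m !ge_min !lexx orbT.
have m0 : 0 <= m by rewrite /m le_min; apply/andP; split; lra.
have : m * z <= 2 * d by nra.
nra.
Qed.

(** The states [0] and [1] weigh at most one each, against [2] at least for
the plain colours together. *)
Lemma low_step x : (90 <= q)%N ->
  (forall c, prob (x c)) -> (forall c, spread 2^-1 (x c)) ->
  \sum_(s : state q | (s < 2)%N) normalize (step x) s <= 2^-1.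
Proof.
move=> q90 px sx.
have cK : (#|'I_q| <= #|plain| + 3)%N.
  rewrite card_ord addnS leqW // card_plain //; lia.
have h2 : 0 < 2^-1 :> R by lra.
have large : 2 <= \sum_(s in plain) step x s.
  have -> : 2 = 4 * 2^-1 :> R by field.
  apply: le_trans (growth _ _ h2 cK _ (lexx _) (x := x) _) _.
  - by move=> c s; case: (px c).
  - by move=> c; case: (px c) => _ ->.
  - by rewrite card_ord.
  - by move=> c s ps; apply: sx.
  by apply: ler_sum => s ps; apply: step_plain_ge.
have low : \sum_(s : state q | (s < 2)%N) step x s <= 2.
  apply: (@le_trans _ _ (\sum_(s : state q | (s < 2)%N) 1)); last first.
    rewrite sumr_const ler_nat.
    apply: (@leq_trans #|[:: ord0; inord 1 : state q]|); last exact: card_size.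
    apply/subset_leq_card/fintype.subsetP => s; rewrite !inE unfold_in.
    by rewrite -!(inj_eq val_inj) /= inordK; lia.
  apply: ler_sum => s s2; apply: step_colour_le1 => //.
  by rewrite -(inj_eq val_inj) /=; lia.
rewrite -mulr_suml ler_pdivrMr ?sum_step_gt0 //.
rewrite [X in 2^-1 * X](bigID (fun s : state q => (s < 2)%N)) /=.
rewrite [X in _ + X](bigID plain) /=.
have -> : \sum_(i : state q | ~~ (i < 2)%N && plain i) step x i
    = \sum_(s in plain) step x s.
  by apply: eq_bigl => s; rewrite /plain unfold_in; lia.
have : 0 <= \sum_(i : state q | ~~ (i < 2)%N && ~~ plain i) step x i.
  by apply: sumr_ge0 => s _; rewrite ltW // step_gt0.
lra.
Qed.

(** Every state has a weight of at least [expR (- beta) ^+ q], so a vertex is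
never certain to have a given colour, whatever its children are. *)
Lemma spread_step0 x : (0 < q)%N -> 0 < lambda -> (forall c, prob (x c)) ->
  spread (expR (- beta) ^+ q / 2) (normalize (step x)).
Proof.
move=> q0 l0 px k /andP[_ kq].
have kstar : k != ord_max by rewrite -(inj_eq val_inj) /= neq_ltn kq.
have := step_gt0 px k; have := step_colour_le1 px kstar.
have := step_ge px k l0; have := step_ge px ord_max l0.
have rest : 0 <= \sum_(s | (s != k) && (s != ord_max)) step x s.
  by apply: sumr_ge0 => s _; rewrite ltW // step_gt0.
rewrite /normalize ler_pdivrMr ?sum_step_gt0 // (bigD1 k) //=.
rewrite (bigD1 ord_max) 1?eq_sym //=; move: rest.
have : 0 <= expR (- beta) ^+ q by rewrite exprn_ge0 // expR_ge0.
set B := _ ^+ q; set z := step x k; set w := step x _; set r := \sum_(i | _) _.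
move=> B0 r0 wB zB z1 z0; nra.
Qed.

Lemma distr_prod (I : finType) (a b : I -> R) :
  (forall i, 0 <= a i <= 1) -> (forall i, 0 <= b i <= 1) ->
  `|\prod_i a i - \prod_i b i| <= \sum_i `|a i - b i|.
Proof.
move=> a01 b01.
pose ok (u v w : R) := [/\ 0 <= u <= 1, 0 <= v <= 1 & `|u - v| <= w].
suff [_ _ //] : ok (\prod_i a i) (\prod_i b i) (\sum_i `|a i - b i|).
apply: (big_rec3 ok).
  by split; rewrite ?ler01 ?lexx // subrr normr0.
move=> i u v w _ [/andP[u0 u1] /andP[v0 v1] uvw].
have /andP[ai0 ai1] := a01 i; have /andP[bi0 bi1] := b01 i.
split; [by rewrite mulr_ge0 ?mulr_ile1| by rewrite mulr_ge0 ?mulr_ile1|].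
have -> : a i * u - b i * v = (a i - b i) * v + a i * (u - v) by ring.
apply: le_trans (ler_normD _ _) _; rewrite !normrM (ger0_norm v0) (ger0_norm ai0).
apply: lerD; first by rewrite ler_piMr.
by apply: le_trans uvw; rewrite ler_piMl.
Qed.

Definition l1 (p p' : state q -> R) := \sum_s `|p s - p' s|.

Lemma edge_avg_l1 s p p' : `|edge_avg s p - edge_avg s p'| <= l1 p p'.
Proof.
rewrite /edge_avg -sumrB; apply: le_trans (ler_norm_sum _ _ _) _.
apply: ler_sum => t _; rewrite -mulrBr normrM ger0_norm ?expR_ge0 //.
by rewrite ler_piMl // edge_le1.
Qed.

(** Probability vectors are determined by their values off [ord_max]. *)
Lemma l1_prob p p' : prob p -> prob p' ->
  l1 p p' <= 2 * \sum_(s | s != ord_max) `|p s - p' s|.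
Proof.
move=> [_ p1] [_ p1']; rewrite /l1 (bigD1 ord_max) //= mulr_natl mulr2n lerD2r.
have -> : p ord_max - p' ord_max = - \sum_(s | s != ord_max) (p s - p' s).
  move: p1 p1'; rewrite (bigD1 ord_max) //= => p1.
  by rewrite (bigD1 ord_max) //= => p1'; rewrite sumrB; lra.
by rewrite normrN; apply: ler_norm_sum.
Qed.

Lemma distr_step x y (D : R) s :
  (forall c, prob (x c)) -> (forall c, prob (y c)) ->
  (forall c, l1 (x c) (y c) <= D) ->
  `|step x s - step y s| <= activity s * (q%:R * D).
Proof.
move=> px py xy; rewrite /step -mulrBr normrM ger0_norm ?expR_ge0 //.
rewrite ler_wpM2l ?expR_ge0 //.
have avg01 z c : (forall c, prob (z c)) -> 0 <= edge_avg s (z c) <= 1.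
  move=> pz; rewrite edge_avg_le1 // edge_avg_ge0 // => t.
  by case: (pz c).
apply: le_trans (distr_prod _ _) _ => [c|c|]; [exact: avg01..|].
apply: (@le_trans _ _ (\sum_(c < q) D)).
  by apply: ler_sum => c _; apply: le_trans (xy c); exact: edge_avg_l1.
by rewrite sumr_const card_ord mulr_natl.
Qed.

Lemma sum_step_ge x : (2 < q)%N -> (forall c, prob (x c)) ->
  (forall c, \sum_(s : state q | (s < 2)%N) x c s <= 2^-1) ->
  expR lambda / 2 ^+ q <= \sum_s step x s.
Proof.
move=> q2 px lx; rewrite (bigD1 ord_max) //= -[leLHS]addr0; apply: lerD.
  rewrite /step activity_star ler_wpM2l ?expR_ge0 // -exprVn.
  rewrite -[X in _ ^+ X](card_ord q) -prodr_const; apply: ler_prod => c _.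
  rewrite invr_ge0 ler0n /=; apply: le_trans (edge_avg_ge1B _ _) => //.
  rewrite (eq_bigl (fun s : state q => (s < 2)%N)); last first.
    by move=> t; rewrite eta_star.
  by have := lx c => ?; lra.
by apply: sumr_ge0 => s _; rewrite ltW // step_gt0.
Qed.

(** The weights of the colours, at most one each, are dwarfed by the total
weight, at least [expR lambda / 2 ^+ q]. This leaves a Lipschitz constant of
order [q ^+ 2 * 4 ^+ q / expR lambda]. *)
Lemma step_contract x y (D : R) : (90 <= q)%N -> 0 <= D ->
  q%:R ^+ 3 * 4 ^+ q.+1 < expR lambda ->
  (forall c, prob (x c)) -> (forall c, prob (y c)) ->
  (forall c, \sum_(s : state q | (s < 2)%N) x c s <= 2^-1) ->
  (forall c, \sum_(s : state q | (s < 2)%N) y c s <= 2^-1) ->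
  (forall c, l1 (x c) (y c) <= D) ->
  l1 (normalize (step x)) (normalize (step y)) <= D / 2.
Proof.
move=> q90 D0 hE px py lx ly xy.
have q2 : (2 < q)%N by lia.
set n : R := q%:R; set E := expR lambda in hE *; set t : R := 2 ^+ q.
have n90 : 90 <= n by rewrite ler_nat.
have t1 : 1 <= t by rewrite exprn_ege1 // ler1n.
have E0 : 0 < E by exact: expR_gt0.
have hE' : 4 * n ^+ 3 * t ^+ 2 <= E.
  apply: le_trans (ltW hE); rewrite le_eqVlt; apply/orP; left; apply/eqP.
  have -> : t ^+ 2 = 4 ^+ q by rewrite -exprM mulnC exprM; congr (_ ^+ q); ring.
  by rewrite (exprS 4 q); ring.
have n3 : 1 <= n ^+ 3 by rewrite exprn_ege1 //; lra.
have nn3 : n <= n ^+ 3 by rewrite ler_eXnr //; lra.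
have t2 : 1 <= t ^+ 2 by rewrite exprn_ege1.
have nE : n <= E by nra.
(* The hypothesis on lambda enters through 4 * n ^+ 3 * e <= 1. *)
set e := t ^+ 2 / E.
have e0 : 0 <= e by rewrite divr_ge0 // ?exprn_ge0 // ltW //; lra.
have e1 : 4 * n ^+ 3 * e <= 1 by rewrite /e mulrA ler_pdivrMr // mul1r.
set W := \sum_s step x s; set W' := \sum_s step y s.
have hW : E / t <= W by exact: sum_step_ge.
have hW' : E / t <= W' by exact: sum_step_ge.
have Et0 : 0 < E / t by rewrite divr_gt0 //; lra.
set v := t / E.
have vE : v = (E / t)^-1 by rewrite invf_div.
have uv : W^-1 <= v.
  by rewrite vE lef_pV2 // posrE; apply: lt_le_trans hW.
have uv' : W'^-1 <= v.
  by rewrite vE lef_pV2 // posrE; apply: lt_le_trans hW'.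
have W0 : 0 < W by apply: lt_le_trans hW.
have W0' : 0 < W' by apply: lt_le_trans hW'.
have ve : v <= e by rewrite /v /e ler_pM2r ?invr_gt0 //; nra.
have v2E : v * v * E = e by rewrite /v /e; field; lra.
have v0 : 0 <= v by rewrite divr_ge0 //; lra.
have dz s : s != ord_max -> `|step x s - step y s| <= n * D.
  move=> sq; rewrite -[leRHS]mul1r -(activity_colour sq).
  exact: distr_step.
(* There are q colours, of activity 1, and the last state has activity E. *)
have dW : `|W' - W| <= (n + E) * (n * D).
  rewrite distrC /W /W' -sumrB; apply: le_trans (ler_norm_sum _ _ _) _.
  rewrite (bigD1 ord_max) //= [leRHS]mulrDl addrC; apply: lerD; last first.
    by rewrite /E -activity_star; exact: distr_step.
  apply: (@le_trans _ _ (\sum_(s : state q | s != ord_max) (n * D))).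
    by apply: ler_sum => s; exact: dz.
  by rewrite sumr_const cardC1 card_ord -[leLHS]mulr_natl.
have dx s : s != ord_max ->
    `|normalize (step x) s - normalize (step y) s| <= 3 * (n * D * e).
  move=> sq; rewrite /normalize -/W -/W'.
  have hz := dz s sq; have z1 := step_colour_le1 px sq.
  have z0 := ltW (step_gt0 px s).
  move: (step x s) (step y s) z0 z1 hz => z z' z0 z1 hz.
  have -> : z / W - z' / W'
      = z * ((W' - W) * (W^-1 * W'^-1)) + (z - z') * W'^-1.
    by field; rewrite !gt_eqF.
  have u0 : 0 <= W^-1 by rewrite invr_ge0 ltW.
  have u0' : 0 <= W'^-1 by rewrite invr_ge0 ltW.
  apply: le_trans (ler_normD _ _) _; rewrite !normrM.
  rewrite (ger0_norm z0) (ger0_norm u0) (ger0_norm u0').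
  have nD : 0 <= n * D by rewrite mulr_ge0 //; lra.
  have h1 : z * (`|W' - W| * (W^-1 * W'^-1))
      <= 1 * ((n + E) * (n * D) * (v * v)).
    have uu : 0 <= W^-1 * W'^-1 by rewrite mulr_ge0.
    apply: ler_pM => //; first by rewrite mulr_ge0.
    by apply: ler_pM => //; apply: ler_pM.
  have h2 : `|z - z'| * W'^-1 <= (n * D) * v by apply: ler_pM.
  have h3 : (n + E) * (v * v) <= 2 * e.
    by rewrite -v2E; have vv := mulr_ge0 v0 v0; nra.
  have h4 : (n * D) * ((n + E) * (v * v)) <= (n * D) * (2 * e).
    by rewrite ler_wpM2l.
  have h5 : (n * D) * v <= n * D * e by rewrite ler_wpM2l.
  lra.
have pnx := prob_step px; have pny := prob_step py.
apply: le_trans (l1_prob pnx pny) _.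
have : \sum_(s : state q | s != ord_max)
    `|normalize (step x) s - normalize (step y) s| <= n * (3 * (n * D * e)).
  apply: (@le_trans _ _ (\sum_(s : state q | s != ord_max) (3 * (n * D * e)))).
    by apply: ler_sum => s; exact: dx.
  by rewrite sumr_const cardC1 card_ord -[leLHS]mulr_natl.
move=> h; suff : 6 * (n ^+ 2 * e) * D <= 2^-1 * D by lra.
rewrite ler_wpM2r //.
have : 0 <= n ^+ 2 * e by rewrite mulr_ge0 // exprn_ge0 //; lra.
have : n ^+ 3 * e = n * (n ^+ 2 * e) by ring.
nra.
Qed.

(** * Loss of memory over many generations *)

Implicit Types (X Y : seq 'I_q -> state q -> R) (w : seq 'I_q).

(** The family [X] is produced by the tree recursion in the [h] generations
that start with [w], from arbitrary laws in the generation after them. *)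
Fixpoint deep h X w : Prop :=
  if h is h'.+1 then
    X w =1 normalize (step (fun c => X (c :: w)))
    /\ forall c, deep h' X (c :: w)
  else prob (X w).

Lemma deep_prob h X w : deep h X w -> prob (X w).
Proof.
elim: h w => [//|h IHh] w [Xw Xc].
have [p0 p1] := prob_step (fun c => IHh _ (Xc c)).
by split=> [s|]; [rewrite Xw | under eq_bigr do rewrite Xw].
Qed.

Lemma deepW m h X w : (m <= h)%N -> deep h X w -> deep m X w.
Proof.
elim: m h w => [|m IHm] [|h] w //; first by move=> _; apply: deep_prob.
by rewrite ltnS => mh [Xw Xc]; split=> // c; apply: IHm mh (Xc c).
Qed.

Lemma spreadW (d d' : R) (p : state q -> R) : d' <= d -> spread d p -> spread d' p.
Proof. by move=> dd ps s /ps /le_trans; apply; rewrite lerD2l lerN2. Qed.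

Lemma spread_deep h X w : (90 <= q)%N -> 0 < lambda -> deep h.+1 X w ->
  spread (Num.min 2^-1 (2 ^+ h * (expR (- beta) ^+ q / 2))) (X w).
Proof.
move=> q90 l0; set d0 := _ / 2.
have d00 : 0 < d0 by rewrite divr_gt0 // exprn_gt0 // expR_gt0.
elim: h w => [|h IHh] w [Xw Xc].
  move=> s ps; rewrite Xw; apply: (@spreadW d0) (ps).
    by rewrite expr0 mul1r ge_min lexx orbT.
  by apply: spread_step0 => [|//|c]; [by lia | exact: Xc].
set d := Num.min _ _.
pose d1 := Num.min 2^-1 (2 ^+ h * d0).
have d1_gt0 : 0 < d1 by rewrite lt_min invr_gt0 ltr0n mulr_gt0 // exprn_gt0.
have d1_le : d1 <= 2^-1 by rewrite ge_min lexx.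
have dd : d <= Num.min 2^-1 (2 * d1).
  rewrite le_min ge_min lexx /=.
  have [] := leP (2^-1 : R) (2 ^+ h * d0) => hd.
    by rewrite /d1 min_l // ge_min; apply/orP; left; lra.
  by rewrite /d1 min_r ?(ltW hd) // mulrA -exprS ge_min lexx orbT.
move=> s ps; rewrite Xw; apply: (spreadW dd) (ps).
by apply: spread_step => // c; [exact: (@deep_prob h.+1 _ _ (Xc c)) | exact: IHh].
Qed.

Lemma low_deep : (90 <= q)%N -> 0 < lambda ->
  exists h, forall X w, deep h X w ->
    \sum_(s : state q | (s < 2)%N) X w s <= 2^-1.
Proof.
move=> q90 l0; set d0 := expR (- beta) ^+ q / 2.
have d00 : 0 < d0 by rewrite divr_gt0 // exprn_gt0 // expR_gt0.
(* h + 1 generations make the children spread by 1/2, and one more is needed for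
the first two colours. *)
pose h := Num.bound (2^-1 / d0); exists h.+2 => X w [Xw Xc].
under eq_bigr do rewrite Xw.
apply: low_step => // c; first exact: (@deep_prob h.+1 _ _ (Xc c)).
apply: (spreadW _ (@spread_deep h _ _ q90 l0 (Xc c))).
rewrite le_min lexx /= -ler_pdivrMr //; apply: ltW.
exact: upper_nthrootP (leqnn _).
Qed.

Lemma l1_le2 p p' : prob p -> prob p' -> l1 p p' <= 2.
Proof.
move=> [p0 p1] [p0' p1']; apply: (@le_trans _ _ (\sum_s (p s + p' s))).
  apply: ler_sum => s _; apply: le_trans (ler_normB _ _) _.
  by rewrite !ger0_norm.
by rewrite big_split /= p1 p1'; lra.
Qed.

Lemma l1_deep : (90 <= q)%N -> 0 < lambda ->
  q%:R ^+ 3 * 4 ^+ q.+1 < expR lambda ->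
  exists h, forall k X Y w, deep (k + h) X w -> deep (k + h) Y w ->
    l1 (X w) (Y w) <= 2 / 2 ^+ k.
Proof.
move=> q90 l0 hE; have [h low] := low_deep q90 l0.
exists h; elim=> [|k IHk] X Y w.
  move=> dX dY; rewrite expr0 divr1.
  by apply: l1_le2; [exact: deep_prob dX | exact: deep_prob dY].
rewrite addSn => -[Xw Xc] [Yw Yc]; rewrite /l1.
under eq_bigr do rewrite Xw Yw.
have -> : 2 / 2 ^+ k.+1 = 2 / 2 ^+ k / 2 :> R by rewrite exprS invfM mulrA mulrAC.
apply: step_contract => //.
- by rewrite divr_ge0 // exprn_ge0.
- by move=> c; exact: deep_prob (Xc c).
- by move=> c; exact: deep_prob (Yc c).
- by move=> c; apply: low; apply: deepW (Xc c); rewrite leq_addl.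
- by move=> c; apply: low; apply: deepW (Yc c); rewrite leq_addl.
- by move=> c; exact: IHk (Xc c) (Yc c).
Qed.

Lemma deep_ge : 0 < lambda ->
  exists2 m, 0 < m & forall X w s, deep 1 X w -> m <= X w s.
Proof.
move=> l0; pose B := expR (- beta) ^+ q; pose U : R := q%:R + expR lambda.
have U0 : 0 < U by rewrite ltr_wpDl ?expR_gt0.
exists (B / U); first by rewrite divr_gt0 // exprn_gt0 // expR_gt0.
move=> X w s [Xw Xc]; rewrite Xw /normalize.
have px c : prob (X (c :: w)) := Xc c.
set x := fun c => _ in px *.
apply: ler_pM.
- by rewrite exprn_ge0 // expR_ge0.
- by rewrite invr_ge0 ltW.
- exact: step_ge.
rewrite lef_pV2 ?posrE ?sum_step_gt0 // (bigD1 ord_max) //= addrC /U.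
apply: lerD; last first.
  rewrite /step activity_star ler_piMr ?expR_ge0 //.
  by case/andP: (hit_le1 px ord_max).
apply: (@le_trans _ _ (\sum_(t : state q | t != ord_max) 1)).
  by apply: ler_sum => t; exact: step_colour_le1.
by rewrite sumr_const cardC1 card_ord.
Qed.

(** Closeness in ratio, unlike in absolute value, passes without any
normalization through the products of the remaining finitely many
generations. *)
Lemma ratio_deep : (90 <= q)%N -> 0 < lambda ->
  q%:R ^+ 3 * 4 ^+ q.+1 < expR lambda -> forall k : R, 1 < k ->
  exists h, forall X Y w s, deep h X w -> deep h Y w -> X w s <= k * Y w s.
Proof.
move=> q90 l0 hE k k1.
have [h close] := l1_deep q90 l0 hE; have [m m0 Xm] := deep_ge l0.
pose b := Num.bound (2 / ((k - 1) * m)).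
(* X <= Y + |X - Y|, and |X - Y| <= (k - 1) * m <= (k - 1) * Y. *)
exists (b + h).+1 => X Y w s dX dY.
have mY := Xm Y w s (deepW (ltn0Sn _) dY).
have km0 : 0 < (k - 1) * m by rewrite mulr_gt0 // subr_gt0.
have XY : X w s - Y w s <= (k - 1) * m.
  apply: le_trans (ler_norm _) _; apply: (@le_trans _ _ (l1 (X w) (Y w))).
    by rewrite /l1 (bigD1 s) //= lerDl sumr_ge0.
  apply: le_trans (close b X Y w _ _) _; [exact: deepW dX | exact: deepW dY|].
  rewrite ler_pdivrMr ?exprn_gt0 // mulrC -ler_pdivrMr //; apply: ltW.
  exact: upper_nthrootP (leqnn _).
nra.
Qed.

(** Unnormalized law of the spin at [w] in terms of the laws [X] at the
vertices [h] generations after it, when the weight of the spin [s] at [v] is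
multiplied by [ind v s]. *)
Fixpoint top (ind : seq 'I_q -> state q -> R) X h w s : R :=
  if h is h'.+1 then
    ind w s * step (fun c => top ind X h' (c :: w)) s
  else X w s.

(** Each of the [q ^ h] laws that enter [top] enters once in every term. *)
Lemma top_le ind X Y (k : R) h w : 0 <= k -> (forall v s, 0 <= ind v s) ->
  (forall v s, size v = (h + size w)%N -> 0 <= X v s <= k * Y v s) ->
  forall s, 0 <= top ind X h w s <= k ^+ (q ^ h) * top ind Y h w s.
Proof.
move=> k0 ind0; elim: h w => [|h IHh] w XY s /=.
  by rewrite expn0 expr1; apply: XY.
have topc c t := IHh (c :: w) (fun v t e => XY v t (etrans e (addnS _ _))) t.
have avg0 c : 0 <= edge_avg s (top ind X h (c :: w)).
  by apply: edge_avg_ge0 => t; case/andP: (topc c t).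
rewrite /step; apply/andP; split.
  by rewrite !mulr_ge0 ?ind0 ?expR_ge0 ?prodr_ge0.
rewrite [leRHS]mulrCA ler_wpM2l ?ind0 // [leRHS]mulrCA.
rewrite ler_wpM2l ?expR_ge0 // expnSr exprM.
rewrite -[X in _ ^+ X * _](card_ord q) -prodr_const -big_split /=.
apply: ler_prod => c _; rewrite avg0 /= /edge_avg mulr_sumr.
apply: ler_sum => t _; rewrite [leRHS]mulrCA ler_wpM2l ?expR_ge0 //.
by case/andP: (topc c t).
Qed.

(** * Partition functions of subtrees *)

Section Messages.
Variables (B : pred (seq 'I_q)) (L : nat).
Hypothesis size_B : forall w, B w -> (size w < L)%N.

Implicit Types (ok : seq 'I_q -> state q -> bool) (ind : seq 'I_q -> state q -> R).

(** Partition function of the subtree of [B] hanging from [w], with the spin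
[s] at [w] and the spin at each vertex [v] restricted by [ok v]; [k] bounds the
height of the subtree. *)
Fixpoint msg_fuel ok k w s : R :=
  if k is k'.+1 then
    (ok w s)%:R * activity s
      * \prod_(c | B (c :: w)) edge_avg s (msg_fuel ok k' (c :: w))
  else 0.

Definition msg ok w := msg_fuel ok (L - size w) w.

Lemma msgE ok w s : (size w < L)%N ->
  msg ok w s = (ok w s)%:R * activity s
    * \prod_(c | B (c :: w)) edge_avg s (msg ok (c :: w)).
Proof. by move=> wL; rewrite {1}/msg -subnSK. Qed.

Lemma msg_ge0 ok w s : 0 <= msg ok w s.
Proof.
rewrite /msg; move: (L - size w)%N => k0; elim: k0 w s => //= k IHk w s.
by rewrite !mulr_ge0 ?expR_ge0 ?ler0n // prodr_ge0 // => c _; rewrite edge_avg_ge0.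
Qed.

Lemma msg_gt0 ok w : (forall v, exists s, ok v s) -> (size w < L)%N ->
  0 < \sum_s msg ok w s.
Proof.
move=> okP; move: {2}(L - size w)%N (erefl (L - size w)%N) => k.
elim: k w => [|k IHk] w wk wL; first by lia.
have [s oks] := okP w; rewrite (bigD1 s) //= ltr_pwDl //; last first.
  by apply: sumr_ge0 => t _; exact: msg_ge0.
rewrite msgE // oks mul1r mulr_gt0 ?expR_gt0 // prodr_gt0 // => c Bc.
have cL := size_B Bc.
have : 0 < \sum_t msg ok (c :: w) t by apply: IHk => //=; move: cL => /=; lia.
rewrite !lt_neqAle edge_avg_ge0 => [|t]; last exact: msg_ge0.
rewrite andbT => /andP[+ _]; apply: contraNneq => h.
rewrite eq_sym psumr_eq0 => [|t _]; last exact: msg_ge0.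
apply/allP => t _; move/esym/psumr_eq0P: h => h.
have /eqP := h (fun t _ => mulr_ge0 (expR_ge0 _) (msg_ge0 _ _ _)) t isT.
by rewrite mulf_eq0 gt_eqF ?expR_gt0.
Qed.

Lemma edge_avgZ s (k : R) (p p' : state q -> R) : (forall t, p t = k * p' t) ->
  edge_avg s p = k * edge_avg s p'.
Proof.
by move=> pE; rewrite /edge_avg mulr_sumr; apply: eq_bigr => t _; rewrite pE mulrCA.
Qed.

Definition law ok w := normalize (msg ok w).

Section Free.
Variables (ok : seq 'I_q -> state q -> bool) (m : nat).
Hypothesis okP : forall v, exists s, ok v s.
Hypothesis (mL : (m < L)%N).
Hypothesis B_free : forall v c, (size v < m)%N -> B (c :: v).
Hypothesis ok_free : forall v s, (size v < m)%N -> ok v s.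

Lemma msg_law w s : (size w < L)%N ->
  msg ok w s = (\sum_t msg ok w t) * law ok w s.
Proof.
by move=> wL; rewrite /law /normalize mulrCA divff ?mulr1 // gt_eqF // msg_gt0.
Qed.

Lemma prob_law w : (size w < L)%N -> prob (law ok w).
Proof.
by move=> wL; apply: prob_normalize (msg_gt0 okP wL) => s; exact: msg_ge0.
Qed.

(** In the generations before [m] the spins are free and no vertex of the tree
is missing, so the recursion applies. *)
Lemma deep_law h w : (size w + h <= m)%N -> deep h (law ok) w.
Proof.
elim: h w => [|h IHh] w; first by move=> wm; apply: prob_law; lia.
rewrite addnS => wm; split=> [s|c]; last by apply: IHh; rewrite addSn.
have wL : (size w < L)%N by lia.
pose k := \prod_c \sum_t msg ok (c :: w) t.
have k0 : k != 0.
  rewrite gt_eqF // prodr_gt0 // => c _; apply: msg_gt0 => //=; lia.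
rewrite -(normalizeZ _ k0) /law /normalize.
have stepE t : msg ok w t = k * step (fun c => law ok (c :: w)) t.
  rewrite msgE // ok_free ?mul1r; last by lia.
  rewrite /step mulrCA -big_split /=; congr (_ * _).
  apply: eq_big => [c|c _]; first by rewrite B_free //; lia.
  by apply: edge_avgZ => u; apply: msg_law => /=; lia.
by congr (_ / _); [|apply: eq_bigr => t _]; exact: stepE.
Qed.

Variables (okA : seq 'I_q -> state q -> bool) (M : nat).
Hypothesis Mm : (M <= m)%N.
Hypothesis okA_deep : forall v s, (M <= size v)%N -> okA v s.

Let okB v s := ok v s && okA v s.

Lemma msg_deep w s : (M <= size w)%N -> msg okB w s = msg ok w s.
Proof.
rewrite /msg; move: (L - size w)%N => k0; elim: k0 w s => //= k IHk w s wM.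
rewrite /okB okA_deep // andbT; congr (_ * _); apply: eq_bigr => c _.
by apply: eq_bigr => t _; rewrite IHk //= leqW.
Qed.

(** Product of the normalizing constants of the laws [h] generations after
[w]. *)
Fixpoint mass h w : R :=
  if h is h'.+1 then \prod_c mass h' (c :: w) else \sum_t msg ok w t.

(** The laws at generation [M] do not see [okA], so the normalizing constants
are the same for all [okA] and cancel in conditional probabilities. *)
Lemma msg_top h w s : (h + size w = M)%N ->
  msg okB w s
  = mass h w * top (fun v t => (okA v t)%:R) (law ok) h w s.
Proof.
elim: h w s => [|h IHh] w s hM.
  by rewrite msg_deep ?msg_law //= -?hM //; lia.
have wL : (size w < L)%N by lia.
rewrite msgE // /okB ok_free /=; last by lia.
have -> : \prod_(c | B (c :: w)) edge_avg s (msg okB (c :: w))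
    = mass h.+1 w * \prod_c edge_avg s
        (top (fun v t => (okA v t)%:R) (law ok) h (c :: w)).
  rewrite /= -big_split /=.
  apply: eq_big => [c|c _]; first by rewrite B_free //; lia.
  by apply: edge_avgZ => t; apply: IHh => /=; lia.
by rewrite /step /=; ring.
Qed.

End Free.
End Messages.

Lemma law_ge0 B L ok w s : 0 <= law B L ok w s.
Proof.
by rewrite /law /normalize divr_ge0 ?msg_ge0 // sumr_ge0 // => t _; rewrite msg_ge0.
Qed.

Lemma eq_msg B L (ok ok' : seq 'I_q -> state q -> bool) w s :
  ok =2 ok' -> msg B L ok w s = msg B L ok' w s.
Proof.
move=> okE; rewrite /msg; move: (L - size w)%N => k; elim: k w s => //= k IHk w s.
rewrite okE; congr (_ * _); apply: eq_bigr => c _.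
by apply: eq_bigr => t _; rewrite IHk.
Qed.

(** Probability, when the spins obey [ok], that they also obey [okA]. *)
Definition cond_msg B L (ok okA : seq 'I_q -> state q -> bool) : R :=
  (\sum_s msg B L (fun v t => ok v t && okA v t) [::] s)
    / \sum_s msg B L ok [::] s.

(** Two boundary conditions give quotients of sums whose numerators, and whose
denominators, agree up to [k ^+ (q ^ M)], one factor [k] for each of the
[q ^ M] vertices of generation [M]. *)
Lemma cond_msg_ratio (k : R) h (B : pred (seq 'I_q)) L m M
    (ok1 ok2 okA : seq 'I_q -> state q -> bool) :
  1 <= k ->
  (forall X Y w s, deep h X w -> deep h Y w -> X w s <= k * Y w s) ->
  (forall w, B w -> size w < L)%N -> (m < L)%N -> (M + h <= m)%N ->
  (forall v c, (size v < m)%N -> B (c :: v)) ->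
  (forall v, exists s, ok1 v s) -> (forall v, exists s, ok2 v s) ->
  (forall v s, (size v < m)%N -> ok1 v s) ->
  (forall v s, (size v < m)%N -> ok2 v s) ->
  (forall v s, (M <= size v)%N -> okA v s) ->
  cond_msg B L ok1 okA <= k ^+ (2 * q ^ M) * cond_msg B L ok2 okA.
Proof.
move=> k1 close sB mL Mm Bf okP1 okP2 of1 of2 oAM.
have k0 : 0 <= k by apply: le_trans k1.
have L0 : (size ([::] : seq 'I_q) < L)%N by rewrite /=; lia.
pose all_ok (v : seq 'I_q) (s : state q) := true.
pose tops ok (oA : seq 'I_q -> state q -> bool) :=
  \sum_s top (fun v t => (oA v t)%:R) (law B L ok) M [::] s.
have topsE (ok oA : seq 'I_q -> state q -> bool) : (forall v, exists s, ok v s) ->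
    (forall v s, (size v < m)%N -> ok v s) ->
    (forall v s, (M <= size v)%N -> oA v s) ->
    \sum_s msg B L (fun v t => ok v t && oA v t) [::] s
    = mass B L ok M [::] * tops ok oA.
  move=> okP okf oAM'; rewrite /tops mulr_sumr; apply: eq_bigr => s _.
  apply: (msg_top sB okP mL Bf okf _ oAM') => //; rewrite ?addn0 //; lia.
have tops_ge0 ok oA : 0 <= tops ok oA.
  apply: sumr_ge0 => s _.
  have ind0 v t : 0 <= (oA v t)%:R :> R by rewrite ler0n.
  have XX v t : size v = (M + size ([::] : seq 'I_q))%N ->
      0 <= law B L ok v t <= 1 * law B L ok v t.
    by rewrite mul1r lexx law_ge0.
  by have /andP[] := top_le ler01 ind0 XX s.
have condE (ok : seq 'I_q -> state q -> bool) : (forall v, exists s, ok v s) ->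
    (forall v s, (size v < m)%N -> ok v s) ->
    cond_msg B L ok okA = tops ok okA / tops ok all_ok
    /\ 0 < tops ok all_ok.
  move=> okP okf.
  have E : \sum_s msg B L ok [::] s = mass B L ok M [::] * tops ok all_ok.
    rewrite -topsE //; apply: eq_bigr => s _; apply: eq_msg => v t.
    by rewrite andbT.
  have := msg_gt0 sB okP L0; rewrite /cond_msg topsE // E => pos.
  have mass0 : mass B L ok M [::] != 0.
    by apply: contraTneq pos => ->; rewrite mul0r ltxx.
  split; first by rewrite -mulf_div divff // mul1r.
  by rewrite lt_neqAle tops_ge0 andbT; apply: contraTneq pos => <-; rewrite mulr0 ltxx.
have tops_le (ok ok' oA : seq 'I_q -> state q -> bool) : (forall v, exists s, ok v s) ->
    (forall v, exists s, ok' v s) ->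
    (forall v s, (size v < m)%N -> ok v s) ->
    (forall v s, (size v < m)%N -> ok' v s) ->
    tops ok oA <= k ^+ (q ^ M) * tops ok' oA.
  move=> okP okP' okf okf'; rewrite /tops mulr_sumr; apply: ler_sum => s _.
  have ind0 v t : 0 <= (oA v t)%:R :> R by rewrite ler0n.
  have XX v t : size v = (M + size ([::] : seq 'I_q))%N ->
      0 <= law B L ok v t <= k * law B L ok' v t.
    rewrite addn0 law_ge0 => vM /=.
    have vh : (size v + h <= m)%N by rewrite vM.
    by apply: close; [apply: (deep_law sB okP mL) | apply: (deep_law sB okP' mL)].
  by have /andP[] := top_le k0 ind0 XX s.
have [-> p1] := condE ok1 okP1 of1; have [-> p2] := condE ok2 okP2 of2.
rewrite mul2n -addnn exprD mulrA ler_pdivlMr // mulrAC ler_pdivrMr //.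
have := tops_le ok1 ok2 okA okP1 okP2 of1 of2.
have := tops_le ok2 ok1 all_ok okP2 okP1 of2 of1.
set K := k ^+ _ => h1 h2.
apply: le_trans (ler_pM (tops_ge0 _ _) (tops_ge0 _ _) h2 h1) _.
by rewrite le_eqVlt; apply/orP; left; apply/eqP; ring.
Qed.

End Step.

(** * Message passing on a finite tree *)

Section FiniteTree.
Variables (R : comPzRingType) (T S : finType) (s0 : S).
Variables (r : T) (p : T -> T) (depth : T -> nat).
Hypothesis depth_p : forall u, u != r -> (depth (p u) < depth u)%N.
Variables (f : T -> S -> R) (e : S -> S -> R) (mu : T -> S -> R).

(** Message from [c] to its parent, as a function of the spin of the parent. *)
Let avg c s := \sum_t e s t * mu c t.

Hypothesis mu_rec : forall u s,
  mu u s = f u s * \prod_(c | (c != r) && (p c == u)) avg c s.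

Implicit Types (D : {set T}) (sigma : {ffun T -> S}).

(** Configurations on [D] are encoded as the configurations on [T] that take
the value [s0] outside [D]. *)
Let supp D sigma := [forall u, (u \notin D) ==> (sigma u == s0)].

Let upd sigma w s : {ffun T -> S} := [ffun u => if u == w then s else sigma u].

(** Weight on [D] after the spins outside [D] have been summed out: the
vertices just outside [D] contribute their messages. *)
Let weight D sigma : R :=
  \prod_(u in D) f u (sigma u)
  * \prod_(u in D | u != r) e (sigma (p u)) (sigma u)
  * \prod_(c | (c \notin D) && (p c \in D)) avg c (sigma (p c)).

Let closed D := r \in D /\ forall u, u \in D -> u != r -> p u \in D.

(** A configuration on [D] is one on [D :\ w] together with a spin at [w]. *)
Lemma sum_supp_D1 D w (G : {ffun T -> S} -> R) : w \in D ->
  \sum_(sigma | supp D sigma) G sigma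
  = \sum_(sigma | supp (D :\ w) sigma) \sum_s G (upd sigma w s).
Proof.
move=> wD.
rewrite (partition_big (fun sigma => upd sigma w s0) (supp (D :\ w))) /=.
  apply: eq_bigr => sigma /forallP ssigma.
  rewrite (reindex_onto (fun s => upd sigma w s) (fun tau => tau w)) /=.
    apply: eq_bigl => s; rewrite ffunE eqxx eqxx andbT; apply/andP; split.
      apply/forallP => u; apply/implyP => uD; rewrite ffunE.
      case: (u =P w) => [uw|_]; first by rewrite uw wD in uD.
      by apply: (implyP (ssigma u)); rewrite !inE negb_and uD orbT.
    apply/eqP/ffunP => u; rewrite !ffunE; case: (_ =P w) => // ->.
    by apply/esym/eqP; apply: (implyP (ssigma w)); rewrite !inE eqxx.
  move=> tau /andP[_ /eqP <-]; apply/ffunP => u; rewrite !ffunE.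
  by case: (_ =P w) => // ->.
move=> sigma /forallP ssigma; apply/forallP => u; rewrite !ffunE !inE negb_and.
rewrite negbK; apply/implyP; case: (u =P w) => //= _ uD.
exact: (implyP (ssigma u)).
Qed.

(** Summing out the spin of a deepest vertex [w] of [D] turns its factor into
the message that [w] sends to its parent. *)
Lemma sum_leaf D w : closed D -> w \in D -> w != r ->
  (forall u, u \in D -> depth u <= depth w)%N ->
  \sum_(sigma | supp D sigma) weight D sigma
  = \sum_(sigma | supp (D :\ w) sigma) weight (D :\ w) sigma.
Proof.
move=> [rD clD] wD wr wmax; rewrite (sum_supp_D1 _ wD).
apply: eq_bigr => sigma _.
have pD u : u \in D -> u != r -> (p u == w) = false.
  move=> uD ur; apply/eqP => pw; have := wmax u uD; rewrite -pw.
  by rewrite leqNgt depth_p.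
have updN u s : u != w -> upd sigma w s u = sigma u.
  by move=> /negPf uw; rewrite ffunE uw.
have updw s : upd sigma w s w = s by rewrite ffunE eqxx.
pose A := \prod_(u in D :\ w) f u (sigma u).
pose B := \prod_(u in D :\ w | u != r) e (sigma (p u)) (sigma u).
pose C := \prod_(c | (c \notin D) && (p c \in D :\ w)) avg c (sigma (p c)).
have weightE s : weight D (upd sigma w s)
    = A * B * C * (e (sigma (p w)) s * mu w s).
  rewrite /weight (big_setD1 w) //= updw.
  have -> : \prod_(u in D :\ w) f u (upd sigma w s u) = A.
    by apply: eq_bigr => u; rewrite !inE => /andP[uw _]; rewrite updN.
  rewrite [X in _ * X * _](bigD1 w) /=; last by rewrite wD.
  rewrite updw updN; last by rewrite pD.
  have -> : \prod_(i | (i \in D) && (i != r) && (i != w))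
      e (upd sigma w s (p i)) (upd sigma w s i) = B.
    rewrite /B; apply: eq_big => [u|u /andP[/andP[uD ur] uw]].
      by rewrite !inE; case: (u == w); case: (u \in D); case: (u == r).
    by rewrite !updN // pD.
  rewrite (bigID (fun c => p c == w)) /=.
  have -> : \prod_(i | (i \notin D) && (p i \in D) && (p i != w))
      avg i (upd sigma w s (p i)) = C.
    rewrite /C; apply: eq_big => [u|u /andP[_ uw]]; last by rewrite updN.
    by rewrite !inE; case: (p u == w); case: (u \in D); case: (p u \in D).
  rewrite mu_rec.
  have -> : \prod_(i | (i \notin D) && (p i \in D) && (p i == w))
      avg i (upd sigma w s (p i))
    = \prod_(c | (c != r) && (p c == w)) avg c s.
    apply: eq_big => [c|c /andP[_ /eqP ->]]; last by rewrite updw.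
    case: (p c =P w) => [pc|]; rewrite ?andbF // !andbT pc wD andbT.
    apply/idP/idP => [|cr]; first by apply: contraNneq => ->.
    by apply/negP => cD; have := pD c cD cr; rewrite pc eqxx.
  by ring.
under eq_bigr => s _ do rewrite weightE.
rewrite -mulr_sumr /weight -/A -/B -!mulrA; congr (_ * (_ * _)).
rewrite [RHS](bigD1 w) /=; last first.
  by rewrite !inE eqxx /= clD // andbT pD.
rewrite mulrC; congr (_ * _); apply: eq_bigl => c.
rewrite !inE negb_and negbK; case: (c =P w) => [->|_]; last by rewrite andbT.
by rewrite wD andbF.
Qed.

(** The vertices are summed out one at a time, deepest first, until only the root
is left. *)
Lemma sum_tree :
  \sum_(sigma : {ffun T -> S})
    (\prod_u f u (sigma u) * \prod_(u | u != r) e (sigma (p u)) (sigma u))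
  = \sum_s mu r s.
Proof.
suff claim n D : #|D| = n.+1 -> closed D ->
    \sum_(sigma | supp D sigma) weight D sigma = \sum_s mu r s.
  have [n cT] : exists n, #|[set: T]| = n.+1.
    by exists #|[set: T]|.-1; rewrite prednK // (cardD1 r) inE.
  have := claim n [set: T] cT; rewrite /closed => <-; last by split.
  apply: eq_big => [sigma|sigma _].
    by apply/esym/forallP => u; rewrite inE.
  rewrite /weight; under [X in _ = _ * X]eq_bigl => c do rewrite inE.
  rewrite big_pred0_eq mulr1; congr (_ * _); first by apply: eq_bigl => u; rewrite inE.
  by apply: eq_bigl => u; rewrite inE.
elim: n D => [|n IHn] D cD [rD clD].
  have /eqP/cards1P[r' Dr] := cD.
  have Er : r' = r by move: rD; rewrite Dr inE => /eqP.
  rewrite {}Er in Dr; rewrite (sum_supp_D1 _ rD).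
  have -> : D :\ r = finset.set0 by rewrite Dr finset.setDv.
  rewrite (big_pred1 [ffun=> s0]); last first.
    move=> sigma; apply/forallP/eqP => [h|-> u]; last by rewrite ffunE eqxx implybT.
    by apply/ffunP => u; rewrite ffunE; apply/eqP; have := h u; rewrite inE.
  apply: eq_bigr => s _; rewrite /weight Dr big_set1 ffunE eqxx mu_rec.
  rewrite big_pred0 ?mulr1; last by move=> u; rewrite inE andbN.
  congr (_ * _); apply: eq_big => [c|c]; first by rewrite !inE.
  by rewrite !inE => /andP[_ /eqP ->]; rewrite ffunE eqxx.
have [w0 w0D w0r] : exists2 w, w \in D & w != r.
  have : (0 < #|D :\ r|)%N by move: cD; rewrite (cardsD1 r) rD add1n => -[->].
  by case/card_gt0P => w; rewrite !inE => /andP[]; exists w.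
have w0P : (w0 \in D) && (w0 != r) by rewrite w0D.
case: (@arg_maxnP T w0 (fun u => (u \in D) && (u != r)) depth w0P) => w.
move=> /andP[wD wr] wmax.
have wmax' u : u \in D -> (depth u <= depth w)%N.
  move=> uD; case: (u =P r) => [->|/eqP ur]; last by apply: wmax; rewrite uD.
  have H : forall k v, (depth v <= k)%N -> (depth r <= depth v)%N.
    elim=> [|k IHk] v vk; case: (v =P r) => [->//|/eqP vr].
      by have := depth_p vr; rewrite leqn0 in vk; rewrite (eqP vk).
    apply: leq_trans (ltnW (depth_p vr)); apply: IHk.
    by rewrite -ltnS; apply: leq_trans (depth_p vr) vk.
  exact: H (leqnn _).
rewrite (@sum_leaf D w) //; apply: IHn.
  by apply: succn_inj; rewrite -cD [in RHS](cardsD1 w) wD add1n.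
split=> [|u]; first by rewrite !inE eq_sym wr.
rewrite !inE => /andP[uw uD] ur; rewrite clD // andbT.
apply/eqP => pw; have := wmax' u uD; rewrite -pw leqNgt.
by rewrite depth_p.
Qed.

End FiniteTree.

(** * Balls and spheres in the tree *)

Section TreeBalls.
Variable q : nat.
Let word := seq 'I_q.
Let G := qtree q.
Implicit Types (u v w : vertex G) (A : {fset vertex G}).

Lemma tree_adjP (u v : word) :
  tree_adj u v -> (exists i, v = i :: u) \/ (exists i, u = i :: v).
Proof. by case/orP => /existsP[i /eqP ->]; [left|right]; exists i. Qed.

Lemma tree_adj_cons (i : 'I_q) (u : word) : tree_adj u (i :: u).
Proof. by apply/orP; left; apply/existsP; exists i. Qed.

Lemma walk_up (u v : word) : @walk G (u ++ v) v (size u).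
Proof.
elim: u => [|i u [p [pp lp sp]]]; first by exists [::].
exists ((u ++ v) :: p); split; rewrite /= ?sp //.
by rewrite pp andbT tree_adj_sym tree_adj_cons.
Qed.

Lemma walk_rcons u v w n : walk u v n -> adj v w -> walk u w n.+1.
Proof.
move=> [p [pp lp sp]] vw; exists (rcons p w).
by rewrite rcons_path pp lp last_rcons size_rcons sp.
Qed.

(** Any two vertices are joined through the root. *)
Lemma walk_root (u v : word) : @walk G u v (size u + size v).
Proof.
elim: v => [|i v IHv]; first by rewrite addn0 -{1}[u]cats0; exact: walk_up.
by rewrite addnS; apply: walk_rcons IHv _; exact: tree_adj_cons.
Qed.

Lemma walk_size (u v : word) n : @walk G u v n -> (size v <= size u + n)%N.
Proof.
move=> [p [pp <- <-]] {n v}; elim: p u pp => [|w p IHp] u /=; first by rewrite addn0.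
case/andP => uw /IHp; move: (last w p) => l.
by case: (tree_adjP uw) => -[i ->] /=; lia.
Qed.

(** The only edge into the subtree of [i :: w] comes from [w], and the length of
[u] keeps [u] outside of that subtree. *)
Lemma walk_enter (u : word) (i : 'I_q) (w : word) n : (size u <= size w)%N ->
  @walk G u (i :: w) n -> exists2 k, (k < n)%N & @walk G u w k.
Proof.
pose below (x : word) := exists y, x = y ++ i :: w.
move=> uw; have {uw} : ~ below u.
  by case=> y uE; move: uw; rewrite uE size_cat /=; lia.
move=> + [p [pp lp <-]] {n}; elim: p u pp lp => [|x p IHp] u /=.
  by move=> _ -> []; exists [::].
move=> /andP[ux pp] lp ub.
have [[y xE]|xb] := pselect (below x).
  case: (tree_adjP ux) => -[j jE].
    case: y xE => [|j' y] xE; last first.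
      by case: ub; exists y; move: xE; rewrite jE => -[].
    exists 0%N => //; exists [::]; split=> //=.
    by move: xE; rewrite jE => -[].
  by case: ub; exists (j :: y); rewrite jE xE.
have [k kp [p' [pp' lp' sp']]] := IHp x pp lp xb.
exists k.+1 => //; exists (x :: p'); split=> //=; last by rewrite sp'.
by rewrite pp' andbT; exact: ux.
Qed.

Lemma ball_walk A n (a u : word) m :
  a \in A -> @walk G a u m -> (m <= n)%N -> @ball_set G A n u.
Proof.
move=> aA aw mn.
have ex : exists k, `[< exists2 b, b \in A & @walk G b u k >].
  by exists m; apply/asboolP; exists a.
have [k /asboolP kP kmin] := ex_minnP ex; exists k.
  by apply: leq_trans mn; apply: kmin; apply/asboolP; exists a.
by split=> // b l bA bw; apply: kmin; apply/asboolP; exists b.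
Qed.

Variables (A : {fset vertex G}) (M n : nat).
Hypothesis A_size : forall a : word, a \in A -> (size a < M)%N.
Hypothesis Mn : (2 * M <= n)%N.

Lemma size_gball (w : word) : w \in gball A n -> (size w < M + n)%N.
Proof.
move=> /in_gball[m mn [[a aA /walk_size aw] _]].
by have := A_size aA; lia.
Qed.

Variable a0 : word.
Hypothesis a0A : a0 \in A.

Lemma gball_small (w : word) : (size w <= n - M)%N -> w \in gball A n.
Proof.
move=> wn; apply/in_gball; apply: ball_walk a0A (walk_root a0 w) _.
by have := A_size a0A; lia.
Qed.

Lemma gsphere_small (w : word) : w \in gsphere A n -> (n - M < size w)%N.
Proof.
move=> /in_gsphere[_ /(_ _ _ a0A (walk_root a0 w))].
by have := A_size a0A; lia.
Qed.

(** Close to the root the ball is the full tree. Beyond generation [M] a walk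
from [A] can reach a vertex only through its parent. *)
Lemma gball_behead (w : word) : w \in gball A n -> behead w \in gball A n.
Proof.
case: w => [//|i w] wB.
have [wn|wn] := leqP (size w) (n - M); first exact: gball_small.
have [m mn [[a aA aw] _]] := (in_gball A n (i :: w)).1 wB.
have [|k km kw] := walk_enter _ aw; first by have := A_size aA; lia.
by apply/in_gball; apply: ball_walk aA kw _; lia.
Qed.

End TreeBalls.

(** * Gibbs measures on finite subtrees *)

(** Agreement with a configuration on a subset, as a constraint on each
spin separately. *)
Lemma restr_okP q (G : lfgraph) (A B : {fset vertex G}) (AB : (A `<=` B)%fset)
    (sigma : {ffun B -> state q}) (tau : {ffun A -> state q}) :
  (restr AB sigma == tau)
  = [forall u : B, oapp (fun a : A => sigma u == tau a) true (insub (val u))].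
Proof.
apply/eqP/forallP => [<- u|h].
  case: insubP => //= a _ au; rewrite ffunE; apply/eqP; congr (sigma _).
  by apply: val_inj; rewrite /= au.
apply/ffunP => a; rewrite ffunE; have := h (fincl AB a).
by rewrite [val _]/= valK /= => /eqP.
Qed.

Section GibbsOnTree.
Variables (R : realType) (q : nat) (lambda beta : R).
Hypothesis (q_gt0 : (0 < q)%N).
Variable B : {fset seq 'I_q}.
Hypothesis (root_B : [::] \in B) (behead_B : forall w, w \in B -> behead w \in B).

Let T : finType := B.
Let r : T := FSetSub root_B.
Let parent (u : T) : T := insubd r (behead (val u)).
Let e : rel T := fun u v => tree_adj (val u) (val v).

Implicit Types (u v : T) (sigma : {ffun T -> state q}).

Let val_parent u : val (parent u) = behead (val u).
Proof. by rewrite val_insubd behead_B ?(valP u). Qed.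

Let r_val u : (u == r) = (val u == [::]).
Proof. by rewrite -(inj_eq val_inj). Qed.

Let up u v := (u != r) && (parent u == v).

Let upE u v : up u v = child (val v) (val u).
Proof.
rewrite /up r_val -(inj_eq val_inj) val_parent /child.
apply/andP/existsP => [[]|[i /eqP ->]]; last by rewrite /= eqxx.
by case: (val u) => [//|i w] _ /= /eqP ->; exists i.
Qed.

Let up_size u v : up u v -> (size (val v) < size (val u))%N.
Proof. by rewrite upE => /existsP[i /eqP ->]. Qed.

(** Each edge joins a vertex to its parent, and is met in both directions. *)
Lemma edge_sum sigma :
  2^-1 * \sum_(uv : T * T | e uv.1 uv.2) (eta (sigma uv.1) (sigma uv.2))%:R
  = \sum_(u | u != r) (eta (sigma (parent u)) (sigma u))%:R :> R.
Proof.
have half : \sum_(uv : T * T | up uv.1 uv.2) (eta (sigma uv.1) (sigma uv.2))%:R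
    = \sum_(u | u != r) (eta (sigma (parent u)) (sigma u))%:R :> R.
  rewrite -(pair_big_dep (fun u => u != r) (fun u v => parent u == v)
    (fun u v => (eta (sigma u) (sigma v))%:R)) /=.
  apply: eq_bigr => u _; rewrite (eq_bigl (pred1 (parent u))) => [|v].
    by rewrite big_pred1_eq etaC.
  by rewrite /= eq_sym.
rewrite (bigID (fun uv => up uv.1 uv.2)) /=.
have -> : \sum_(uv : T * T | e uv.1 uv.2 && up uv.1 uv.2)
    (eta (sigma uv.1) (sigma uv.2))%:R
  = \sum_(u | u != r) (eta (sigma (parent u)) (sigma u))%:R :> R.
  rewrite -half; apply: eq_bigl => -[u v]; rewrite /= /e /tree_adj -!upE.
  by case: (up u v); rewrite ?orbT ?andbF.
have -> : \sum_(uv : T * T | e uv.1 uv.2 && ~~ up uv.1 uv.2)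
    (eta (sigma uv.1) (sigma uv.2))%:R
  = \sum_(u | u != r) (eta (sigma (parent u)) (sigma u))%:R :> R.
  have swapK : involutive (fun uv : T * T => (uv.2, uv.1)) by case.
  rewrite -half (reindex_inj (inv_inj swapK)) /=.
  apply: eq_big => [[u v]|[u v] _]; last by rewrite /= etaC.
  rewrite /= /e /tree_adj -!upE.
  case uv: (up u v); case vu: (up v u) => //=.
  by have := ltn_trans (up_size uv) (up_size vu); rewrite ltnn.
by lra.
Qed.

Lemma gibbs_weightE sigma :
  gibbs_weight lambda beta e sigma
  = \prod_u activity lambda (sigma u)
    * \prod_(u | u != r) edge beta (sigma (parent u)) (sigma u).
Proof.
rewrite /gibbs_weight edge_sum expRD -expR_sum -mulr_sumr; congr (_ * _).
by rewrite -expR_sum sumrN -mulr_sumr.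
Qed.

Variable L : nat.
Hypothesis size_B : forall w, w \in B -> (size w < L)%N.

Let msgB := msg lambda beta (fun w => w \in B) L.

Lemma sum_gibbs_weight (ok : seq 'I_q -> state q -> bool) :
  \sum_(sigma : {ffun T -> state q} | [forall u, ok (val u) (sigma u)])
    gibbs_weight lambda beta e sigma
  = \sum_s msgB ok [::] s.
Proof.
have rec u s : msgB ok (val u) s = (ok (val u) s)%:R * activity lambda s
    * \prod_(c | (c != r) && (parent c == u))
        \sum_t edge beta s t * msgB ok (val c) t.
  rewrite {1}/msgB msgE; last exact: size_B (valP u).
  congr (_ * _); pose i0 := Ordinal q_gt0.
  rewrite [RHS](reindex_onto (fun i => insubd r (i :: val u) : T)
    (fun c => head i0 (val c))) /=; last first.
    move=> c /andP[]; rewrite r_val => cr /eqP cu; apply: val_inj.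
    rewrite -cu val_parent.
    have cE : head i0 (val c) :: behead (val c) = val c.
      by case: (val c) cr.
    by rewrite cE valKd.
  apply: eq_big => [i|i iB]; last by rewrite val_insubd iB.
  rewrite r_val -(inj_eq val_inj) val_parent val_insubd.
  case: ifP => // iB.
  by rewrite -[fsval (insubd _ _)]/(val _) val_insubd iB /= !eqxx.
have depth_parent u : u != r -> (size (val (parent u)) < size (val u))%N.
  by move=> ur; apply: up_size; rewrite /up ur eqxx.
have := sum_tree ord0 depth_parent (fun u s => rec u s).
rewrite [val r]/= => <-; rewrite big_mkcond /=; apply: eq_bigr => sigma _.
rewrite gibbs_weightE big_split /= -mulrA.
case: ifP => [/forallP h|/negbT]; last first.
  rewrite negb_forall => /existsP[u /negPf oku].
  by rewrite (bigD1 u) //= oku !mul0r.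
by rewrite [in RHS]big1 ?mul1r // => u _; rewrite h.
Qed.

(** The partition function of the whole ball cancels in a conditional
probability. *)
Lemma gibbs_condE (okA okS : seq 'I_q -> state q -> bool)
    (E F : pred {ffun T -> state q}) :
  (forall sigma, E sigma = [forall u, okA (val u) (sigma u)]) ->
  (forall sigma, F sigma = [forall u, okS (val u) (sigma u)]) ->
  gibbs_cond lambda beta e E F
  = cond_msg lambda beta (fun w => w \in B) L okS okA.
Proof.
move=> EE FE.
have Z0 : @gibbs_Z R q lambda beta T e != 0.
  rewrite gt_eqF // /gibbs_Z (bigD1 [ffun=> ord0]) //= ltr_pwDl ?expR_gt0 //.
  by apply: sumr_ge0 => sigma _; rewrite expR_ge0.
rewrite /gibbs_cond /gibbs_pr /gibbs -!mulr_suml -mulf_div divff ?mulr1; last first.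
  by rewrite invr_eq0.
rewrite /cond_msg -!sum_gibbs_weight; congr (_ / _); apply: eq_bigl => sigma.
  rewrite /= EE FE; apply/andP/forallP => [[/forallP hE /forallP hF] u|h].
    by rewrite hE hF.
  by split; apply/forallP => u; case/andP: (h u).
by rewrite FE.
Qed.

End GibbsOnTree.

(** * Uniqueness *)

Lemma gibbs_cond_itv (R : realType) q (lambda beta : R) (T : finType) (e : rel T)
    (E F : pred {ffun T -> state q}) : 0 <= gibbs_cond lambda beta e E F <= 1.
Proof.
have g0 (sigma : {ffun T -> state q}) : 0 <= gibbs lambda beta e sigma.
  by rewrite /gibbs divr_ge0 ?expR_ge0 // sumr_ge0 // => *; rewrite expR_ge0.
have pr0 (P : pred {ffun T -> state q}) : 0 <= gibbs_pr lambda beta e P by exact: sumr_ge0.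
rewrite /gibbs_cond divr_ge0 //=.
have le : gibbs_pr lambda beta e (predI E F) <= gibbs_pr lambda beta e F.
  rewrite /gibbs_pr [leRHS](bigID E) /=.
  under eq_bigl do rewrite andbC.
  by rewrite lerDl sumr_ge0.
have := pr0 F; rewrite le_eqVlt => /predU1P[<-|F0].
  by rewrite invr0 mulr0 ler01.
by rewrite ler_pdivrMr ?mul1r.
Qed.

Lemma ratio_dist (R : realDomainType) (K x y : R) : 1 <= K ->
  0 <= x <= 1 -> 0 <= y <= 1 -> x <= K * y -> y <= K * x -> `|x - y| <= K - 1.
Proof.
move=> K1 /andP[x0 x1] /andP[y0 y1] xy yx; rewrite ler_norml.
by apply/andP; split; nra.
Qed.

Lemma exprn_root (R : realType) (K : R) n : (0 < n)%N -> 1 < K ->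
  exists2 k, 1 < k & k ^+ n = K.
Proof.
move=> n0 K1; have K0 : 0 < K by apply: lt_trans K1.
exists (expR (ln K / n%:R)).
  by rewrite -[ltLHS]expR0 ltr_expR divr_gt0 ?ltr0n // ln_gt0.
by rewrite -expRM_natl mulrC divfK ?lnK // pnatr_eq0 -lt0n.
Qed.

Section Boundary.
Variables (R : realType) (q : nat) (lambda beta : R).
Hypotheses (q90 : (90 <= q)%N) (lambda_gt0 : 0 < lambda) (beta_gt0 : 0 < beta).
Hypothesis exp_lambda : q%:R ^+ 3 * 4%:R ^+ q.+1 < expR lambda.

Let G := qtree q.

(** The ball has depth less than [M + n], and the spins before generation
[n - M] are free. *)
Lemma boundary_law_ratio (k : R) h (A : {fset vertex G}) (a0 : vertex G) M n
    (xi1 xi2 : {ffun gsphere A n -> state q}) (tau : {ffun A -> state q}) :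
  1 <= k ->
  (forall (X Y : seq 'I_q -> state q -> R) w s, deep lambda beta h X w ->
     deep lambda beta h Y w -> X w s <= k * Y w s) ->
  a0 \in A -> (forall a : seq 'I_q, a \in A -> (size a < M)%N) ->
  (2 * M + h <= n)%N ->
  boundary_law lambda beta xi1 tau
  <= k ^+ (2 * q ^ M) * boundary_law lambda beta xi2 tau.
Proof.
move=> k1 close a0A AM Mn.
have M2 : (2 * M <= n)%N by apply: leq_trans Mn; rewrite leq_addr.
have M0 := AM _ a0A.
pose okS (xi : {ffun gsphere A n -> state q}) (v : seq 'I_q) (s : state q) :=
  oapp (fun u : gsphere A n => s == xi u) true (insub v).
pose okA (v : seq 'I_q) (s : state q) :=
  oapp (fun u : A => s == tau u) true (insub v).
have lawE xi : boundary_law lambda beta xi tau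
    = cond_msg lambda beta (fun w => w \in gball A n) (M + n) (okS xi) okA.
  have q0 : (0 < q)%N by lia.
  have root : [::] \in gball A n by apply: (gball_small AM M2 a0A).
  have beh w : w \in gball A n -> behead w \in gball A n.
    exact: (gball_behead AM M2 a0A).
  have size_lt w : w \in gball A n -> (size w < M + n)%N by exact: size_gball.
  apply: (gibbs_condE lambda beta q0 root beh size_lt).
  - by move=> sigma; rewrite restr_okP.
  - by move=> sigma; rewrite restr_okP.
rewrite !lawE.
have okP xi v : exists s, okS xi v s.
  rewrite /okS; case: (insub v : option (gsphere A n)) => [u|].
    by exists (xi u) => /=.
  by exists ord0.
have ok_free xi v s : (size v < n - M)%N -> okS xi v s.
  move=> vn; rewrite /okS insubF //; apply/negP => /(gsphere_small AM M2 a0A).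
  by lia.
apply: (cond_msg_ratio beta_gt0 (m := (n - M)%N) k1 close) => //.
- by move=> w; apply: size_gball.
- by lia.
- by lia.
- by move=> v c vn; apply: (gball_small AM M2 a0A).
- exact: ok_free.
- exact: ok_free.
- by move=> v s vM; rewrite /okA insubF //; apply/negP => /AM; lia.
Qed.

Lemma boundary_empty (A : {fset vertex G}) n
    (xi1 xi2 : {ffun gsphere A n -> state q}) :
  A = fset0 -> xi1 = xi2.
Proof.
move=> A0; apply/ffunP => -[u uS]; exfalso.
by have [[a]] := (in_gsphere A n u).1 uS; rewrite A0 inE.
Qed.

Lemma dTV_boundary_law (A : {fset vertex G}) (eps : R) : 0 < eps ->
  exists N, forall n (xi1 xi2 : {ffun gsphere A n -> state q}), (N <= n)%N ->
    dTV (boundary_law lambda beta xi1) (boundary_law lambda beta xi2) <= eps.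
Proof.
move=> eps0; have [A0|[a0 a0A]] := fset_0Vmem A.
  exists 0%N => n xi1 xi2 _; rewrite (boundary_empty xi1 xi2 A0) /dTV.
  by rewrite big1 ?mulr0 ?ltW // => tau _; rewrite subrr normr0.
pose M := (\max_(a : A) size (val a : seq 'I_q)).+1.
have AM (a : seq 'I_q) : a \in A -> (size a < M)%N.
  by move=> aA; rewrite ltnS; apply: (leq_bigmax (FSetSub aA : A)).
pose c : R := #|{: {ffun A -> state q}}|%:R.
have c0 : 0 < c by rewrite ltr0n; apply/card_gt0P; exists [ffun=> ord0].
(* c is the number of terms of the distance, each at most eps / c. *)
have K1 : 1 < 1 + eps / c by rewrite ltrDl divr_gt0.
have qM : (0 < 2 * q ^ M)%N by rewrite muln_gt0 expn_gt0; lia.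
have [k k1 kK] := exprn_root qM K1.
have [h close] := ratio_deep beta_gt0 q90 lambda_gt0 exp_lambda k1.
exists (2 * M + h)%N => n xi1 xi2 nN.
have ratio xi xi' tau := boundary_law_ratio xi xi' tau (ltW k1) close a0A AM nN.
rewrite /dTV; apply: (@le_trans _ _ (2^-1 * \sum_(tau : {ffun A -> state q}) (eps / c))).
  rewrite ler_wpM2l ?invr_ge0 // ler_sum // => tau _.
  have -> : eps / c = (1 + eps / c) - 1 by ring.
  apply: ratio_dist; rewrite ?gibbs_cond_itv ?(ltW K1) //.
    by rewrite -kK; apply: ratio.
  by rewrite -kK; apply: ratio.
rewrite sumr_const -[X in _ * X]mulr_natr.
have -> : eps / c * #|{: {ffun A -> state q}}|%:R = eps.
  by apply: divfK; rewrite gt_eqF.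
by lra.
Qed.

End Boundary.

Theorem theorem1 (R : realType) (q : nat) (lambda beta : R)
  (hq : (90 <= q)%N)
  (hlambda : 0 < lambda)
  (hexp : q%:R ^+ 3 * 4%:R ^+ q.+1 < expR lambda)
  (hbeta : 0 < beta) :
  gibbs_uniqueness q lambda beta (qtree q).
Proof.
move=> A; apply/cvgrPdist_le => eps eps0.
have [N dN] := dTV_boundary_law hq hlambda hbeta hexp A eps0.
exists N => // n /= Nn; rewrite sub0r normrN.
set E := (X in sup X).
have E_le : ubound E eps by move=> _ [xi1 [xi2 ->]]; exact: dN.
pose xi : {ffun gsphere A n -> state q} := [ffun=> ord0].
have xiE : E (dTV (boundary_law lambda beta xi) (boundary_law lambda beta xi)).
  by exists xi, xi.
have sup0 : 0 <= sup E.
  apply: le_trans (ub_le_sup _ xiE); last by exists eps.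
  by rewrite /dTV mulr_ge0 ?invr_ge0 ?sumr_ge0.
rewrite ger0_norm //; apply: ge_sup => //.
by exists (dTV (boundary_law lambda beta xi) (boundary_law lambda beta xi)).
Qed.
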